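(* Let $C_\phi$ be a composition operator on a directed graph with one circuit (as defined in the context). If $C_\phi\in\boldsymbol B(L^2(\mu))$ is an $m$-isometry for some integer $m\ge2$, then $C_\phi$ is analytic.
   Context: Setting. $\mathbb N=\{1,2,\ldots\}$. Let $\kappa\in\mathbb N$, $\eta\in\mathbb N\cup\{\infty\}$, $J_{[1,\eta]}=\{i\in\mathbb N: i\le\eta\}$ (so $J_{[1,\infty]}=\mathbb N$), and let $X=\{x_1,\ldots,x_\kappa\}\cup\{x_{i,j}: i\in J_{[1,\eta]},\, j\in\mathbb N\}$, all the listed points being distinct. Let $\mathscr A$ be the $\sigma$-algebra of all subsets of $X$ and $\mu$ a positive measure on $\mathscr A$ with $\mu(x):=\mu(\{x\})\in(0,\infty)$ for all $x\in X$. Define $\phi\colon X\to X$ by $\phi(x_{i,j})=x_{i,j-1}$ for $j\ge2$, $\phi(x_{i,1})=x_\kappa$, $\phi(x_1)=x_\kappa$, and $\phi(x_i)=x_{i-1}$ for $2\le i\le\kappa$. The operator $C_\phi f=f\circ\phi$ in the complex space $L^2(\mu)=L^2(X,\mathscr A,\mu)$ is called a composition operator on a directed graph with one circuit. $C_\phi\in\boldsymbol B(L^2(\mu))$ means that $C_\phi$ is everywhere defined and bounded on $L^2(\mu)$. A bounded operator $T$ on a Hilbert space is an $m$-isometry if $\sum_{k=0}^m(-1)^k\binom mk T^{*k}T^k=0$. $C_\phi$ is analytic if $\bigcap_{n=1}^\infty C_\phi^n(L^2(\mu))=\{0\}$. *)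

(* Defs.v *)
From HB Require Import structures.
From mathcomp Require Import all_boot all_order all_algebra.
From mathcomp Require Import all_classical all_reals all_analysis.
From mathcomp Require Import ring.
From mathcomp.real_closed Require Import complex.

Set Implicit Arguments.
Unset Strict Implicit.
Unset Printing Implicit Defensive.

Import Order.TTheory GRing.Theory Num.Theory.
Import ComplexField.Normc.

Local Open Scope classical_set_scope.
Local Open Scope ring_scope.

(* The number eta of branches lies in {1, 2, ...} u {oo}; [None] encodes oo.
   Indices start at 0 here: branch index i stands for i + 1. *)
Definition in_branches (eta : option nat) : pred nat :=
  fun i => if eta is Some e then (i < e)%N else true.

Definition branch_index (eta : option nat) : Type :=
  {i : nat | in_branches eta i}.

HB.instance Definition _ (eta : option nat) := Choice.on (branch_index eta).

(* The circuit has kappa = k + 1 >= 1 vertices.  [inl i] is x_(i+1), so that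
   [inl ord_max] is x_kappa, and [inr (i, j)] is x_(i+1, j+1). *)
Definition vertex (k : nat) (eta : option nat) : Type :=
  ('I_k.+1 + branch_index eta * nat)%type.

HB.instance Definition _ k eta := Choice.on (vertex k eta).
HB.instance Definition _ k eta :=
  isPointed.Build (vertex k eta) (inl ord_max : vertex k eta).

(* The sigma-algebra of all subsets. *)
HB.instance Definition _ k eta :=
  @isMeasurable.Build default_measure_display (vertex k eta)
    discrete_measurable discrete_measurable0
    discrete_measurableC discrete_measurableU.

Definition phi k eta (v : vertex k eta) : vertex k eta :=
  match v with
  | inl i => inl (if i == ord0 then ord_max else inord i.-1)
  | inr (_, 0%N) => inl ord_max
  | inr (i, j.+1) => inr (i, j)
  end.

Fact normc_ge0 (R : rcfType) (x : R[i]) : 0 <= normc x.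
Proof. by case: x => a b; exact: sqrtr_ge0. Qed.

Fact normcD_sqr (R : rcfType) (x y : R[i]) :
  normc (x + y) ^+ 2 <= 2 * normc x ^+ 2 + 2 * normc y ^+ 2.
Proof.
have h : normc (x + y) ^+ 2 <= (normc x + normc y) ^+ 2.
  by rewrite ler_sqr ?nnegrE ?addr_ge0 ?normc_ge0 // le_normcD.
apply: (le_trans h); rewrite -subr_ge0.
set a := normc x; set b := normc y.
have -> : 2 * a ^+ 2 + 2 * b ^+ 2 - (a + b) ^+ 2 = (a - b) ^+ 2 by ring.
exact: sqr_ge0.
Qed.

Section L2.
Context (k : nat) (eta : option nat) (R : realType).
Variable mu : {measure set (vertex k eta) -> \bar R}.

Definition square_integrable : {pred vertex k eta -> R[i]} := fun f =>
  (\int[mu]_x (normc (f x) ^+ 2)%:E < +oo)%E.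

Fact square_integrable_submod : GRing.submod_closed square_integrable.
Proof.
split.
  rewrite /square_integrable unfold_in /=.
  rewrite integral0_eq ?ltry // => x _.
  by rewrite /= expr0n /= addr0 sqrtr0 expr0n.
move=> a f g; rewrite !unfold_in => hf hg.
have N (z : R[i]) : 0 <= normc z ^+ 2 by exact: sqr_ge0.
have c0 : 0 <= 2 * normc a ^+ 2 by exact: mulr_ge0.
pose F x : \bar R := ((2 * normc a ^+ 2)%:E * (normc (f x) ^+ 2)%:E)%E.
pose G x : \bar R := (2%:E * (normc (g x) ^+ 2)%:E)%E.
have F0 x : (0 <= F x)%E by apply: mule_ge0; rewrite lee_fin.
have G0 x : (0 <= G x)%E by apply: mule_ge0; rewrite lee_fin.
have mf d (T : measurableType d) (h : vertex k eta -> T) : measurable_fun setT h.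
  by [].
apply: (@le_lt_trans _ _ (\int[mu]_x (F x + G x))%E).
  apply: ge0_le_integral => //.
  - by move=> x _; rewrite lee_fin.
  - move=> x _; rewrite /F /G -!EFinM -EFinD lee_fin -mulrA -exprMn.
    by rewrite -normcM; exact: normcD_sqr.
rewrite ge0_integralD // lte_add_pinfty //.
- rewrite ge0_integralZl_EFin //; first by rewrite lte_mul_pinfty // lee_fin.
  by move=> x _; rewrite lee_fin.
- rewrite ge0_integralZl_EFin //; first by rewrite lte_mul_pinfty // lee_fin.
  by move=> x _; rewrite lee_fin.
Qed.

HB.instance Definition _ := GRing.isSubmodClosed.Build R[i]
  (vertex k eta -> R[i]) square_integrable square_integrable_submod.

(* The elements are functions rather than almost-everywhere classes: this is
   L^2(mu) only when every vertex has positive mass, so that the null function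
   is the only one vanishing almost everywhere.  Measurability is automatic. *)
Record L2 : Type := MkL2 {
  L2_fun :> vertex k eta -> R[i];
  _ : L2_fun \in square_integrable }.

HB.instance Definition _ := [isSub for L2_fun].
HB.instance Definition _ := [Choice of L2 by <:].
HB.instance Definition _ := [SubChoice_isSubLmodule of L2 by <:].

(* The library integrates real functions only; the integral of a complex
   function is taken on real and imaginary parts. *)
Definition cintegral (f : vertex k eta -> R[i]) : R[i] :=
  Complex (\int[mu]_x complex.Re (f x)) (\int[mu]_x complex.Im (f x)).

Definition dotL2 (f g : L2) : R[i] := cintegral (fun x => f x * conjc (g x)).

Definition normL2 (f : L2) : R :=
  Num.sqrt (\int[mu]_x (normc (f x) ^+ 2)).

Definition bounded_operator (T : L2 -> L2) : Prop :=
  linear T /\ exists M : R, forall f, normL2 (T f) <= M * normL2 f.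

Definition is_adjoint (T S : L2 -> L2) : Prop :=
  forall f g, dotL2 (T f) g = dotL2 f (S g).

(* The adjoint of a bounded operator exists (Riesz) and is unique, so
   "exists S" only names it. *)
Definition m_isometry (m : nat) (T : L2 -> L2) : Prop :=
  exists2 S : L2 -> L2, is_adjoint T S &
    forall f : L2, \sum_(j < m.+1)
      ((-1) ^+ j * 'C(m, j)%:R : R[i]) *: iter j S (iter j T f) = 0.

Definition analytic (T : L2 -> L2) : Prop :=
  \bigcap_(n in [set n | (1 <= n)%N]) range (iter n T) = [set 0].

(* T is C_phi, everywhere defined on L^2(mu). *)
Definition is_composition_operator (T : L2 -> L2) : Prop :=
  forall f : L2, T f = f \o @phi k eta :> (vertex k eta -> R[i]).

End L2.

(* Main.v *)
Require Import Defs.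
From mathcomp Require Import all_boot all_order all_algebra.
From mathcomp Require Import all_classical all_reals all_analysis.
From mathcomp Require Import lra zify.
From mathcomp.real_closed Require Import complex.

(** Fix a branch b and write a(n) for the mass of its n-th vertex.  The next
    vertex of the branch is the only preimage of a branch vertex under phi, so C
    moves the indicator of a vertex of b to the indicator of the next one.  Testing the m-isometry identity
    on such indicators says that the m-th difference of a vanishes
    ([mass_recurrence]): a is a polynomial sequence.  A polynomial sequence is
    either zero or eventually bounded away from zero, with a constant sign
    ([iter_decrement_eq0_away_from0]); as masses are positive, a(n) >= c > 0
    for large n.

    Let now f lie in the range of every power of C, so that f is constant on
    the fibers of every power of phi.  Any two vertices lying at the same
    distance, modulo the length of the circuit, from x_kappa are eventually
    merged by phi; hence each value f x is taken at a whole arithmetic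
    progression of vertices of b ([phi_branch_merge]).  If f x <> 0, square integrability of f makes the sum of a over that
    progression finite, contradicting the lower bound
    ([mass_not_eventually_above]).  So f = 0. *)

Import Order.TTheory GRing.Theory Num.Theory.
Import ComplexField.Normc.

Local Open Scope classical_set_scope.
Local Open Scope ring_scope.

(** * Sequences with a vanishing iterated difference *)

Section Differences.
Context {R : realType}.
Implicit Types a : nat -> R.

(** The difference with this sign has exactly the alternating sum of an
    m-isometry as its m-th iterate. *)
Definition decrement a : nat -> R := fun n => a n - a n.+1.

Lemma iter_decrement m a n :
  iter m decrement a n = \sum_(j < m.+1) (-1) ^+ j * 'C(m, j)%:R * a (n + j)%N.
Proof.
elim: m n => [|m IHm] n.
  by rewrite big_ord_recr big_ord0 /= bin0 expr0 !mul1r add0r addn0.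
rewrite iterS /decrement !IHm.
(* Pascal's rule, once the two sums are shifted against each other. *)
rewrite [X in X - _]big_ord_recl [X in _ - X]big_ord_recr.
rewrite [RHS]big_ord_recl [in RHS]big_ord_recr /=.
rewrite !bin0 !binn opprD !addrA; congr (_ + _); last first.
- by rewrite addSnnS exprS; lra.
- rewrite -addrA; congr (_ + _).
  rewrite -sumrN -big_split /=; apply: eq_bigr => j _.
  by rewrite /bump /= add1n binS natrD addSnnS exprS; lra.
Qed.

Definition eventually_above a (c : R) := exists N, forall n, (N <= n)%N -> c <= a n.

(** A sequence losing at least c at each step tends to -oo; the bound 1 is just
    a convenient positive constant. *)
Lemma eventually_above_decrement a c :
  0 < c -> eventually_above (decrement a) c -> eventually_above (fun n => - a n) 1.
Proof.
move=> c0 [N hN].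
have grow p : c * p%:R - a N <= - a (N + p)%N.
  elim: p => [|p IHp]; first by rewrite addn0 mulr0 sub0r.
  have := hN _ (leq_addr p N); rewrite /decrement addnS -natr1; lra.
have [p hp] : exists p : nat, (1 + a N) / c < p%:R.
  by exists (Num.truncn ((1 + a N) / c)).+1; exact: truncnS_gt.
exists (N + p)%N => n hn; rewrite -(subnKC (leq_trans (leq_addr p N) hn)).
apply: le_trans (grow _).
rewrite lerBrDr; apply: (@le_trans _ _ (c * p%:R)).
  by rewrite mulrC -ler_pdivrMr // ltW.
by rewrite ler_pM2l // ler_nat; lia.
Qed.

(** The dichotomy for polynomial sequences, without polynomials: by induction
    on m the difference of a is zero, and a is constant, or it is eventually
    bounded away from 0 with a constant sign, and a diverges to an infinity.
    Both signs have to be carried through the induction. *)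
Lemma iter_decrement_eq0_away_from0 m a : (forall n, iter m decrement a n = 0) ->
  (forall n, a n = 0) \/
  (exists2 c, 0 < c & eventually_above a c \/ eventually_above (fun n => - a n) c).
Proof.
elim: m a => [|m IHm] a; first by move=> h; left.
move=> ha; have [|d0|[c c0 [h|h]]] := IHm (decrement a).
- by move=> n; rewrite -iterSr.
- have aE n : a n = a 0%N.
    by elim: n => // n <-; have /eqP := d0 n; rewrite /decrement subr_eq0 => /eqP.
  have [a0|a0|a0] := ltgtP (a 0%N) 0.
  + by right; exists (- a 0%N); [rewrite oppr_gt0|right; exists 0%N => n _; rewrite aE].
  + by right; exists (a 0%N) => //; left; exists 0%N => n _; rewrite aE.
  + by left=> n; rewrite aE.
- by right; exists 1 => //; right; exact: eventually_above_decrement h.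
- right; exists 1 => //; left.
  have [] := @eventually_above_decrement (fun n => - a n) c c0.
    by case: h => N h; exists N => n /h; rewrite /decrement /=; lra.
  by move=> N hN; exists N => n /hN; rewrite opprK.
Qed.

End Differences.

(** * Merging of orbits in the graph *)

Section Graph.
Context {k : nat} {eta : option nat}.
Implicit Types v : vertex k eta.

Lemma iter_phi_circuit (i : 'I_k.+1) : iter i.+1 (@phi k eta) (inl i) = inl ord_max.
Proof.
case: i => i; elim: i => [|i IHi] hi; first by rewrite /=.
rewrite iterSr -[RHS](IHi (ltnW hi)); congr (iter _ _ _); congr inl.
by apply: val_inj; rewrite /= inordK //; exact: ltnW.
Qed.

Lemma iter_phi_branch b j : iter j.+1 (@phi k eta) (inr (b, j)) = inl ord_max.
Proof. by elim: j => // j IHj; rewrite iterSr. Qed.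

Lemma iter_phi_period q : iter (k.+1 * q) (@phi k eta) (inl ord_max) = inl ord_max.
Proof.
elim: q => [|q IHq]; first by rewrite muln0.
by rewrite mulnS iterD IHq (iter_phi_circuit ord_max).
Qed.

(** If v reaches x_kappa in r + 1 steps, then going round the circuit q more
    times brings it back there after r + 1 + q * kappa steps, which is just when
    the vertex of b at index r + q * kappa reaches x_kappa. *)
Lemma phi_branch_merge b v : exists r, forall q, exists2 n, (1 <= n)%N &
  iter n (@phi k eta) v = iter n (@phi k eta) (inr (b, r + k.+1 * q)%N).
Proof.
have [r hr] : exists r, iter r.+1 (@phi k eta) v = inl ord_max.
  case: v => [i|[c j]]; first by exists i; exact: iter_phi_circuit.
  by exists j; exact: iter_phi_branch.
exists r => q; exists (r + k.+1 * q).+1 => //.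
by rewrite iter_phi_branch -addSn addnC iterD hr iter_phi_period.
Qed.

End Graph.

(** * Masses along a branch *)

Section Operator.
Context {R : realType} {k : nat} {eta : option nat}.
Context {mu : {measure set (vertex k eta) -> \bar R}}.
Hypothesis mu_pos : forall x : vertex k eta, (0 < mu [set x] < +oo)%E.
Local Notation V := (vertex k eta).
Implicit Types (x y : V) (f g : L2 mu) (C S : L2 mu -> L2 mu).

Definition mass x : R := fine (mu [set x]).

Lemma massE x : mu [set x] = (mass x)%:E.
Proof.
have /andP[m0 moo] := mu_pos x.
by rewrite /mass fineK // ge0_fin_numE // ltW.
Qed.

Lemma mass_gt0 x : 0 < mass x.
Proof. by rewrite -lte_fin -massE; have /andP[] := mu_pos x. Qed.

Lemma integral_point x (h : V -> R) : (forall y, y != x -> h y = 0) ->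
  (\int[mu]_y (h y)%:E = (h x * mass x)%:E)%E.
Proof.
move=> h0; have mx : measurable [set x] by [].
rewrite EFinM -massE -integral_cst // [RHS]integral_mkcond.
apply: eq_integral => y _; rewrite patchE; case: ifPn => [|yx].
  by rewrite inE => ->.
by rewrite h0 //; apply: contraNneq yx => ->; rewrite inE.
Qed.

Definition point_fun x : V -> R[i] := fun y => (y == x)%:R.

Lemma point_fun_square_integrable x : point_fun x \in square_integrable mu.
Proof.
rewrite unfold_in /=; rewrite (integral_point x) ?ltry // => y /negPf yx.
by rewrite /point_fun yx normc0 expr0n.
Qed.

Definition delta x : L2 mu := MkL2 (point_fun_square_integrable x).

(** Pairing with an indicator evaluates the other vector, so the vector identity
    defining an m-isometry can be read off pointwise. *)
Lemma dotL2_delta x g : dotL2 (delta x) g = conjc (g x) * (mass x)%:C%C.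
Proof.
have zero y : y != x -> delta x y * conjc (g y) = 0.
  by move=> /negPf yx; rewrite /= /point_fun yx mul0r.
have one : delta x x * conjc (g x) = conjc (g x).
  by rewrite /= /point_fun eqxx mul1r.
rewrite /dotL2 /cintegral /Rintegral.
rewrite (integral_point x); last by move=> y /zero ->.
rewrite (integral_point x); last by move=> y /zero ->.
rewrite one /=; case: (g x) => a b /=.
by apply/eqP; rewrite eq_complex /= !mulr0 subr0 add0r !eqxx.
Qed.

Lemma iter_adjoint C S n : is_adjoint C S -> is_adjoint (iter n C) (iter n S).
Proof.
move=> CS; elim: n => // n IHn f g.
by rewrite iterS CS IHn -iterSr.
Qed.

Lemma iter_composition C n f x :
  is_composition_operator C -> iter n C f x = f (iter n (@phi k eta) x).
Proof.
by move=> hC; elim: n x => // n IHn x; rewrite iterS hC /= IHn -iterSr.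
Qed.

(** The preimage of a branch vertex is the single next vertex of the branch.
    At x_kappa this fails, as every branch contributes a preimage. *)
Lemma iter_composition_delta C b n j : is_composition_operator C ->
  iter j C (delta (inr (b, n))) = delta (inr (b, n + j)%N).
Proof.
move=> hC; elim: j => [|j IHj]; first by rewrite addn0.
rewrite iterS IHj; apply: val_inj; rewrite /= hC; apply/funext => y /=.
congr ((nat_of_bool _)%:R).
rewrite addnS; case: y => [i|[c [|l]]] //=.
by apply/eqP/eqP => //; case=> -> ->.
Qed.

(** The identity sum_j (-1)^j C(m, j) |C^j f|^2 = 0, with f the indicator of the
    n-th vertex of b, whose image under C^j has squared norm a(n + j). *)
Lemma mass_recurrence C m b n : is_composition_operator C -> m_isometry m C ->
  \sum_(j < m.+1) (-1) ^+ j * 'C(m, j)%:R * mass (inr (b, n + j)%N) = 0.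
Proof.
move=> hC [S CS hS]; set x : V := inr (b, n).
(* <f, S^j C^j f> = <C^j f, C^j f> for f the indicator of x, and there <f, g>
   is the conjugate of g x times the mass of x. *)
have diag j : iter j S (iter j C (delta x)) x * (mass x)%:C%C
    = (mass (inr (b, n + j)%N))%:C%C.
  have := dotL2_delta x (iter j S (iter j C (delta x))).
  rewrite -(iter_adjoint _ _ j CS) {1 2}iter_composition_delta // dotL2_delta /=.
  rewrite /point_fun eqxx conjc1 mul1r => /(congr1 (@conjc R)).
  by rewrite rmorphM /= conjcK oppr0 => /esym.
have /(congr1 (fun h : L2 mu => L2_fun h x * (mass x)%:C%C)) := hS (delta x).
(* Evaluation at x commutes with sums, by definition of addition in L2. *)
rewrite (big_morph (fun h : L2 mu => L2_fun h x) (fun _ _ => erefl) erefl).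
rewrite [X in _ = X -> _]mul0r mulr_suml => sum0.
apply: (@complexI R).
rewrite rmorph0 -[RHS]sum0 rmorph_sum; apply: eq_bigr => j _.
have scaleE (a : R[i]) (g : L2 mu) : L2_fun (a *: g) x = a * g x by [].
by rewrite scaleE -[RHS]mulrA diag !rmorphM rmorphXn rmorphN rmorph1 rmorph_nat.
Qed.

(** The vertices of b where f takes the nonzero value z have finite total mass
    because |f|^2 is integrable; infinitely many of them have mass at least c. *)
Lemma mass_not_eventually_above f b r z c : z != 0 -> 0 < c ->
  (forall q, f (inr (b, r + k.+1 * q)%N) = z) ->
  ~ eventually_above (fun n => mass (inr (b, n))) c.
Proof.
move=> z_neq0 c0 fz [N hN].
(* Starting the progression at N + q puts all its indices above N. *)
pose p q : V := inr (b, r + k.+1 * (N + q))%N.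
pose A := \bigcup_q [set p q].
have p_disjoint : trivIset setT (fun q => [set p q]).
  apply: ltn_trivIset => i j ij; apply/disjoints_subset => y /= -> [] /eqP.
  rewrite eqn_add2l eqn_pmul2l // eqn_add2l => /eqP ji.
  by rewrite ji ltnn in ij.
have A_large Q : ((c * Q%:R)%:E <= mu A)%E.
  rewrite /A measure_bigcup //.
  apply: le_trans (nneseries_lim_ge Q _); last by move=> *; exact: measure_ge0.
  rewrite mulr_natr -[Q in _ *+ Q]subn0 -sumr_const_nat -sumEFin.
  rewrite [leRHS]big_mkcond; apply: lee_sum => q _.
  rewrite mem_set // massE lee_fin; apply: hN; nia.
have w0 : 0 < normc z ^+ 2.
  rewrite exprn_gt0 // lt_neqAle normc_ge0 andbT eq_sym.
  by apply: contra z_neq0 => /eqP /eq0_normc ->.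
have f_large : ((normc z ^+ 2)%:E * mu A <= \int[mu]_y (normc (f y) ^+ 2)%:E)%E.
  rewrite -integral_cst // (@eq_integral _ _ _ mu A (fun y => (normc (f y) ^+ 2)%:E)).
    by apply: ge0_subset_integral => // y _; rewrite lee_fin sqr_ge0.
  by move=> y; rewrite inE => -[q _ ->]; rewrite fz.
have := le_lt_trans f_large (valP f : _ \in square_integrable mu).
case: (mu A) A_large => [t| |] A_large; last by have := A_large 0%N.
- move=> _; have := A_large (Num.truncn (t / c)).+1.
  by rewrite lee_fin leNgt mulrC -ltr_pdivrMr // truncnS_gt.
- by rewrite gt0_muley // lte_fin.
Qed.

End Operator.

Theorem corollary4p3 (R : realType) (k : nat) (eta : option nat)
  (eta_gt0 : eta <> Some 0%N)
  (mu : {measure set (vertex k eta) -> \bar R})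
  (mu_pos : forall x : vertex k eta, (0 < mu [set x] < +oo)%E)
  (C : L2 mu -> L2 mu) (C_comp : is_composition_operator C)
  (C_bounded : bounded_operator C)
  (m : nat) (m_ge2 : (2 <= m)%N) (C_miso : m_isometry m C) :
  analytic C.
Proof.
have b : branch_index eta.
  by exists 0%N; case: eta eta_gt0 {mu mu_pos C C_comp C_bounded C_miso} => [[]|].
rewrite /analytic; apply/seteqP; split => f /=; last first.
  move=> -> n _; exists 0 => //; apply: val_inj; apply/funext => x.
  by rewrite /= iter_composition.
move=> f_range; apply: val_inj; apply/funext => x; apply/eqP; apply/negPn/negP.
move=> fx_neq0.
have f_merge n y z : (1 <= n)%N ->
    iter n (@phi k eta) y = iter n (@phi k eta) z -> f y = f z.
  by move=> /f_range[g _ <-]; rewrite !iter_composition // => ->.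
have [r hr] := phi_branch_merge b x.
have f_branch q : f (inr (b, r + k.+1 * q)%N) = f x.
  by have [n n1 /esym /f_merge] := hr q; exact.
have [a0|[c c0 [above|[N below]]]] := @iter_decrement_eq0_away_from0 R m
  (fun n => mass (mu := mu) (inr (b, n)))
  (fun n => etrans (iter_decrement _ _ _) (mass_recurrence mu_pos C m b n C_comp C_miso)).
- by have := mass_gt0 mu_pos (inr (b, 0%N)); rewrite a0 ltxx.
- exact: (mass_not_eventually_above mu_pos f b r (f x) c).
- have := mass_gt0 mu_pos (inr (b, N)); have := below N (leqnn N); lra.
Qed.
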